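(* Let $p\in[2,\infty)$ and let $A,B\in M_n(\mathbb{C})$. Then: (1) $$w_p\left(\begin{bmatrix} 0 & B \\ B & 0 \end{bmatrix}\right)=2^{1/p}\,w_p(B).$$ (2) $$w_p\left(\begin{bmatrix} A & B \\ B & A \end{bmatrix}\right)\le\frac{1}{2^{\frac2p-1}}\Big(w_p^p(A+B)+w_p^p(A-B)\Big)^{1/p},$$ and if $A$ and $B$ are Hermitian, then $$w_p\left(\begin{bmatrix} A & B \\ B & A \end{bmatrix}\right)=\Big(w_p^p(A+B)+w_p^p(A-B)\Big)^{1/p}.$$
   Context: For $p\in[1,\infty)$, $\|\cdot\|_p$ denotes the Schatten $p$-norm on $M_m(\mathbb{C})$, $\|Y\|_p=(\sum_j s_j(Y)^p)^{1/p}$ with $s_j(Y)$ the singular values of $Y$. The Schatten $p$-generalized numerical radius is $w_p(Y)=\sup_{\theta\in\mathbb{R}}\|\mathrm{Re}(e^{i\theta}Y)\|_p$, where $\mathrm{Re}(Z)=\frac12(Z+Z^* )$. The notation $w_p^p(Y)$ means $(w_p(Y))^p$. Block matrices are elements of $M_{2n}(\mathbb{C})$ with $n\times n$ blocks. *)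

(* Defs.v *)
From mathcomp Require Import all_boot all_order all_algebra.
From mathcomp Require Import complex.
From mathcomp Require Import all_classical all_reals all_analysis.

Set Implicit Arguments.
Unset Strict Implicit.
Unset Printing Implicit Defensive.

Import Order.TTheory GRing.Theory Num.Theory.
Local Open Scope classical_set_scope.
Local Open Scope ring_scope.
Local Open Scope sesquilinear_scope.

(* The eigenvalues of the Hermitian (hence normal) matrix Y^* Y, listed with
   multiplicity by [spectral_diag], are real and nonnegative as elements of
   R[i]; taking [complex.Re] brings them to R without losing anything. *)
Definition singular_value (R : realType) (m : nat) (Y : 'M[R[i]]_m)
    (j : 'I_m) : R :=
  Num.sqrt (complex.Re (spectral_diag (Y^t* *m Y) 0 j)).

Definition schatten (R : realType) (p : R) (m : nat) (Y : 'M[R[i]]_m) : R :=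
  (\sum_(j < m) singular_value Y j `^ p) `^ (1 / p).

Definition Re_mx (R : realType) (m : nat) (Z : 'M[R[i]]_m) : 'M[R[i]]_m :=
  2^-1 *: (Z + Z^t*).

Definition expi (R : realType) (theta : R) : R[i] :=
  (cos theta +i* sin theta)%C.

(* The supremum is taken in R: the set is nonempty, and it is bounded because
   the entries of Re (e^{i theta} Y) are bounded uniformly in theta. *)
Definition schatten_numradius (R : realType) (p : R) (m : nat)
    (Y : 'M[R[i]]_m) : R :=
  sup [set schatten p (Re_mx (expi theta *: Y)) | theta in [set: R]].

(* Main.v *)
Require Import Defs.
From mathcomp Require Import all_boot all_order all_algebra.
From mathcomp Require Import complex.
From mathcomp Require Import all_classical all_reals all_analysis.

Set Implicit Arguments.
Unset Strict Implicit.
Unset Printing Implicit Defensive.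

Import Order.TTheory GRing.Theory Num.Theory.
Local Open Scope ring_scope.
Local Open Scope sesquilinear_scope.

(* Conjugation by [[1, 0], [1, 1]] makes [[P, Q], [Q, P]] block triangular with
   diagonal blocks P + Q and P - Q.  For the Gram matrix of X = [[A, B], [B, A]]
   these blocks are the Gram matrices of A + B and A - B, so the singular values
   of X are those of A + B together with those of A - B.  The form of X is
   preserved by Re (e^{i theta} X), whence
     ||Re (e^{i theta} X)||_p^p
       = ||Re (e^{i theta} (A + B))||_p^p + ||Re (e^{i theta} (A - B))||_p^p,
   and it remains to take suprema: the upper bound holds without the factor
   2^{1 - 2/p} >= 1, for A = 0 both terms are equal, and for Hermitian blocks
   both suprema are attained at theta = 0. *)

Section CharPoly.
Variable F : fieldType.

Lemma char_poly_similar n (P M N : 'M[F]_n) :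
  P \in unitmx -> P *m M = N *m P -> char_poly M = char_poly N.
Proof.
move=> uP PM; have /(congr1 (@determinant _ _)) :
    map_mx polyC P *m char_poly_mx M = char_poly_mx N *m map_mx polyC P.
  by rewrite /char_poly_mx mulmxBr mulmxBl -!map_mxM PM scalar_mxC.
rewrite !det_mulmx mulrC => /mulIf; apply.
by rewrite det_map_mx polyC_eq0 -unitfE -unitmxE.
Qed.

Lemma char_poly_ublock n1 n2 (A : 'M[F]_n1) (B : 'M[F]_(n1, n2)) (D : 'M[F]_n2) :
  char_poly (block_mx A B 0 D) = char_poly A * char_poly D.
Proof.
rewrite /char_poly /char_poly_mx map_block_mx scalar_mx_block.
by rewrite opp_block_mx add_block_mx map_mx0 subrr det_ublock.
Qed.

Lemma char_poly_symblock n (P Q : 'M[F]_n) :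
  char_poly (block_mx P Q Q P) = char_poly (P + Q) * char_poly (P - Q).
Proof.
rewrite -(char_poly_ublock (P + Q) Q (P - Q)).
apply: (@char_poly_similar _ (block_mx 1%:M 0 (- 1%:M) 1%:M)).
  by rewrite unitmxE det_lblock !det1 mulr1 unitr1.
rewrite !mulmx_block !mul1mx !mulmx1 !mul0mx !mulmx0 !mulNmx !mulmxN !mul1mx.
by rewrite !mulmx1 !add0r !addr0 addrK opprB [- P + Q]addrC [- Q + P]addrC.
Qed.

End CharPoly.

Section SpectralDiag.
Variable C : numClosedFieldType.

Lemma char_poly_diagonalized n (P : 'M[C]_n) (d : 'rV_n) :
  P \in unitmx ->
  char_poly (invmx P *m diag_mx d *m P) = \prod_j ('X - (d 0 j)%:P).
Proof.
move=> uP; rewrite (@char_poly_similar _ _ P _ (diag_mx d)) //.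
  rewrite char_poly_trig ?diag_mx_is_trig //.
  by apply: eq_bigr => i _; rewrite !mxE eqxx.
by rewrite !mulmxA mulmxV // mul1mx.
Qed.

Lemma char_poly_normal n (M : 'M[C]_n) :
  M \is normalmx -> char_poly M = \prod_j ('X - (spectral_diag M 0 j)%:P).
Proof.
by move/orthomx_spectralP => {1}->; apply/char_poly_diagonalized/spectral_unit.
Qed.

Lemma gram_normal m n (Y : 'M[C]_(m, n)) : Y^t* *m Y \is normalmx.
Proof.
by apply/normalmxP; rewrite trmx_mul map_mxM map_trmx trmxK -map_mx_comp
  (map_mx_id (@conjCK _)).
Qed.

Lemma hermsymmxD n (A B : 'M[C]_n) :
  A \is hermsymmx -> B \is hermsymmx -> A + B \is hermsymmx.
Proof.
move=> /is_hermitianmxP hA /is_hermitianmxP hB; apply/is_hermitianmxP.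
by rewrite {1}hA {1}hB !expr0 !scale1r [(A + B)^T]linearD map_mxD.
Qed.

Lemma hermsymmxB n (A B : 'M[C]_n) :
  A \is hermsymmx -> B \is hermsymmx -> A - B \is hermsymmx.
Proof.
move=> /is_hermitianmxP hA /is_hermitianmxP hB; apply/is_hermitianmxP.
by rewrite {1}hA {1}hB !expr0 !scale1r [(A - B)^T]linearB map_mxB.
Qed.

Lemma char_poly_gram_symblock n (A B : 'M[C]_n) :
  char_poly ((block_mx A B B A)^t* *m block_mx A B B A) =
  char_poly ((A + B)^t* *m (A + B)) * char_poly ((A - B)^t* *m (A - B)).
Proof.
rewrite tr_block_mx map_block_mx mulmx_block.
rewrite [X in block_mx _ _ X _]addrC [X in block_mx _ _ _ X]addrC.
rewrite char_poly_symblock; congr (_ * _); congr char_poly.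
  by rewrite [(A + B)^T]linearD map_mxD mulmxDl !mulmxDr addrACA;
    congr (_ + _); rewrite addrC.
by rewrite [(A - B)^T]linearB map_mxB mulmxBl !mulmxBr opprB opprD addrACA.
Qed.

Lemma sum_spectral_diag (V : nmodType) n (M : 'M[C]_n) (s : seq C) (f : C -> V) :
  M \is normalmx -> char_poly M = \prod_(x <- s) ('X - x%:P) ->
  \sum_j f (spectral_diag M 0 j) = \sum_(x <- s) f x.
Proof.
move=> /char_poly_normal ->; rewrite -(big_map _ xpredT (fun x => 'X - x%:P)).
by move=> /prod_XsubC_eq/(perm_big _) <-; rewrite big_map.
Qed.

Lemma spectral_diag_gramE m n (Y : 'M[C]_(m, n)) j :
  spectral_diag (Y^t* *m Y) 0 j =
  \sum_k `|(Y *m (spectralmx (Y^t* *m Y))^t*) k j| ^+ 2.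
Proof.
have /orthomx_spectralP := gram_normal Y.
set P := spectralmx _; set d := spectral_diag _ => eY.
have uP : P \is unitarymx by exact: spectral_unitarymx.
have : diag_mx d = (Y *m P^t*)^t* *m (Y *m P^t*).
  rewrite trmx_mul map_mxM map_trmx trmxK -map_mx_comp (map_mx_id (@conjCK _)).
  rewrite mulmxA -(mulmxA P) eY -invmx_unitary // !mulmxA mulmxV ?unitarymx_unit //.
  by rewrite mul1mx mulmxK ?unitarymx_unit.
move=> /matrixP/(_ j j); rewrite !mxE eqxx mulr1n => ->.
by apply: eq_bigr => k _; rewrite !mxE normCKC.
Qed.

Lemma spectral_diag_gram_ge0 m n (Y : 'M[C]_(m, n)) j :
  0 <= spectral_diag (Y^t* *m Y) 0 j.
Proof. by rewrite spectral_diag_gramE sumr_ge0 // => k _; rewrite exprn_ge0. Qed.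

Lemma spectral_diag_gram_le m n (Y : 'M[C]_(m, n)) j :
  spectral_diag (Y^t* *m Y) 0 j <= \sum_k \sum_l `|Y k l| ^+ 2.
Proof.
have -> : \sum_k \sum_l `|Y k l| ^+ 2 = \sum_i spectral_diag (Y^t* *m Y) 0 i.
  rewrite -mxtrace_diag exchange_big /=.
  transitivity (\tr (Y^t* *m Y)); last first.
    have /orthomx_spectralP {1}-> := gram_normal Y.
    by rewrite mxtrace_mulC mulmxA mulmxV ?spectral_unit // mul1mx.
  apply: eq_bigr => l _; rewrite !mxE.
  by apply: eq_bigr => k _; rewrite !mxE normCKC.
rewrite (bigD1 j) //= lerDl sumr_ge0 // => i _; exact: spectral_diag_gram_ge0.
Qed.

End SpectralDiag.

Section Schatten.
Variable R : realType.
Implicit Types (p c : R) (n : nat).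

Lemma schatten_ge0 p n (Y : 'M[R[i]]_n) : 0 <= schatten p Y.
Proof. exact: powR_ge0. Qed.

Lemma sum_singular_value_ge0 p n (Y : 'M[R[i]]_n) :
  0 <= \sum_j singular_value Y j `^ p.
Proof. by rewrite sumr_ge0 // => j _; rewrite powR_ge0. Qed.

Lemma powR_invK p x : p != 0 -> 0 <= x -> (x `^ (1 / p)) `^ p = x.
Proof. by move=> p0 x0; rewrite -powRrM mul1r mulVf // powRr1. Qed.

Lemma powRK_inv p x : p != 0 -> 0 <= x -> (x `^ p) `^ (1 / p) = x.
Proof. by move=> p0 x0; rewrite -powRrM mul1r mulfV // powRr1. Qed.

Lemma schatten_powR p n (Y : 'M[R[i]]_n) :
  p != 0 -> schatten p Y `^ p = \sum_j singular_value Y j `^ p.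
Proof. by move=> p0; rewrite powR_invK // sum_singular_value_ge0. Qed.

Lemma sum_singular_value p n (Y : 'M[R[i]]_n) (s : seq R[i]) :
  char_poly (Y^t* *m Y) = \prod_(x <- s) ('X - x%:P) ->
  \sum_j singular_value Y j `^ p = \sum_(x <- s) Num.sqrt (complex.Re x) `^ p.
Proof.
move=> /(sum_spectral_diag (fun x => Num.sqrt (complex.Re x) `^ p)) -> //.
exact: gram_normal.
Qed.

Lemma schatten_symblock p n (A B : 'M[R[i]]_n) : p != 0 ->
  schatten p (block_mx A B B A) =
  (schatten p (A + B) `^ p + schatten p (A - B) `^ p) `^ (1 / p).
Proof.
move=> p0; rewrite [in LHS]/schatten; congr (powR _ _).
rewrite [X in _ = X + _]schatten_powR // [X in _ = _ + X]schatten_powR //.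
pose d (M : 'M[R[i]]_n) : seq R[i] :=
  [seq spectral_diag (M^t* *m M) 0 j | j <- index_enum 'I_n].
have dE (M : 'M[R[i]]_n) :
    char_poly (M^t* *m M) = \prod_(x <- d M) ('X - x%:P).
  by rewrite big_map char_poly_normal ?gram_normal.
have /(@sum_singular_value p) -> :
    char_poly ((block_mx A B B A)^t* *m block_mx A B B A) =
    \prod_(x <- d (A + B) ++ d (A - B)) ('X - x%:P); last first.
  by rewrite big_cat /= !big_map.
by rewrite big_cat -!dE char_poly_gram_symblock.
Qed.

Lemma schattenZ p c n (Y : 'M[R[i]]_n) : p != 0 ->
  schatten p (c%:C%C *: Y) = `|c| * schatten p Y.
Proof.
move=> p0; rewrite /schatten.
pose d := spectral_diag (Y^t* *m Y).
rewrite (@sum_singular_value _ _ _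
    [seq (c ^+ 2)%:C%C * d 0 j | j <- index_enum 'I_n]).
  rewrite big_map -[in RHS](powRK_inv p0 (normr_ge0 c)).
  rewrite -powRM ?powR_ge0 ?sum_singular_value_ge0 //.
  congr (powR _ _); rewrite mulr_sumr; apply: eq_bigr => j _.
  rewrite -powRM ?sqrtr_ge0 // /singular_value -/d; congr (powR _ _).
  rewrite -sqrtr_sqr -sqrtrM ?sqr_ge0 //; congr Num.sqrt.
  by case: (d 0 j) => a b /=; rewrite mul0r subr0.
rewrite big_map.
have -> : (c%:C%C *: Y)^t* *m (c%:C%C *: Y) =
    invmx (spectralmx (Y^t* *m Y)) *m diag_mx ((c ^+ 2)%:C%C *: d)
      *m spectralmx (Y^t* *m Y).
  rewrite [(_ *: Y)^T]linearZ /= map_mxZ -scalemxAl -scalemxAr scalerA.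
  rewrite [diag_mx _]linearZ /= -scalemxAr -scalemxAl.
  have /orthomx_spectralP := gram_normal Y; rewrite -/d => <-.
  congr (_ *: _).
  by rewrite -[(_%:C%C)^*]/(c%:C^*)%C /= oppr0;
    rewrite -[(c +i* 0)%C]/(c%:C)%C -rmorphM -expr2.
by rewrite char_poly_diagonalized ?spectral_unit //;
  apply: eq_bigr => j _; rewrite mxE.
Qed.

Lemma schattenN p n (Y : 'M[R[i]]_n) : p != 0 -> schatten p (- Y) = schatten p Y.
Proof.
by move=> p0; have := schattenZ (- 1) Y p0; rewrite rmorphN scaleN1r normrN1 mul1r.
Qed.

Lemma Re_mxD n (X Y : 'M[R[i]]_n) : Re_mx (X + Y) = Re_mx X + Re_mx Y.
Proof. by rewrite /Re_mx [(X + Y)^T]linearD map_mxD -scalerDr addrACA. Qed.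

Lemma Re_mxN n (X : 'M[R[i]]_n) : Re_mx (- X) = - Re_mx X.
Proof. by rewrite /Re_mx [(- X)^T]linearN map_mxN -opprD scalerN. Qed.

Lemma Re_mx_symblock n (A B : 'M[R[i]]_n) :
  Re_mx (block_mx A B B A) = block_mx (Re_mx A) (Re_mx B) (Re_mx B) (Re_mx A).
Proof.
by rewrite /Re_mx tr_block_mx map_block_mx add_block_mx scale_block_mx.
Qed.

Lemma norm_expi (t : R) : `|expi t| = 1.
Proof. by rewrite normc_def /= cos2Dsin2 sqrtr1. Qed.

Definition schatten_rotated p n (t : R) (Y : 'M[R[i]]_n) : R :=
  schatten p (Re_mx (expi t *: Y)).

Lemma schatten_rotated_symblock p n t (A B : 'M[R[i]]_n) : p != 0 ->
  schatten_rotated p t (block_mx A B B A) =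
  (schatten_rotated p t (A + B) `^ p + schatten_rotated p t (A - B) `^ p)
    `^ (1 / p).
Proof.
move=> p0; rewrite {1}/schatten_rotated scale_block_mx Re_mx_symblock.
rewrite (schatten_symblock _ _ p0).
rewrite /schatten_rotated scalerDr scalerBr.
by rewrite !Re_mxD Re_mxN.
Qed.

Lemma schatten_rotated_herm p n t (H : 'M[R[i]]_n) : p != 0 ->
  H \is hermsymmx -> schatten_rotated p t H = `|cos t| * schatten p H.
Proof.
move=> p0 /is_hermitianmxP; rewrite expr0 scale1r => hH.
rewrite -(schattenZ _ _ p0) /schatten_rotated; congr (schatten _ _).
rewrite /Re_mx [(_ *: H)^T]linearZ /= map_mxZ -hH -scalerDl scalerA; congr (_ *: _).
rewrite -[X in _ * (_ + X)]/((expi t)^*)%C.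
apply/(canLR (mulKf _)); first by rewrite pnatr_eq0.
by rewrite mulr_natl mulr2n; apply/eqP; rewrite eq_complex /= subrr addr0 !eqxx.
Qed.

Lemma schatten_rotated0_herm p n (H : 'M[R[i]]_n) : p != 0 ->
  H \is hermsymmx -> schatten_rotated p 0 H = schatten p H.
Proof. by move=> p0 hH; rewrite schatten_rotated_herm // cos0 normr1 mul1r. Qed.

Lemma norm_Re_mx_le n t (Y : 'M[R[i]]_n) k l :
  `|Re_mx (expi t *: Y) k l| <= \sum_i \sum_j `|Y i j|.
Proof.
have leY i j : `|Y i j| <= \sum_i \sum_j `|Y i j|.
  rewrite (bigD1 i) //= (bigD1 j) //= -addrA lerDl addr_ge0 ?sumr_ge0 // => *.
  by rewrite sumr_ge0.
rewrite !mxE normrM normfV normr_nat mulrC ler_pdivrMr ?ltr0n // mulr_natr mulr2n.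
by rewrite (le_trans (ler_normD _ _)) // norm_conjC !normrM norm_expi !mul1r lerD.
Qed.

Lemma has_ubound_schatten_rotated p n (Y : 'M[R[i]]_n) : 0 < p ->
  has_ubound [set schatten_rotated p t Y | t in [set: R]].
Proof.
move=> p0; pose K : R[i] := \sum_(k < n) \sum_(l < n) (\sum_i \sum_j `|Y i j|) ^+ 2.
exists ((\sum_(j < n) Num.sqrt (complex.Re K) `^ p) `^ (1 / p)) => _ [t _ <-].
have ge0e : 0 <= 1 / p by rewrite divr_ge0 ?(ltW p0).
apply: ge0_ler_powR => //; rewrite ?nnegrE ?sum_singular_value_ge0 //.
  by rewrite sumr_ge0 // => j _; rewrite powR_ge0.
apply: ler_sum => j _.
apply: ge0_ler_powR; rewrite ?nnegrE ?sqrtr_ge0 ?(ltW p0) //.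
apply: ler_wsqrtr.
suff : spectral_diag ((Re_mx (expi t *: Y))^t* *m Re_mx (expi t *: Y)) 0 j <= K.
  by rewrite lecE => /andP[].
apply: le_trans (spectral_diag_gram_le _ _) _.
by do 2![apply: ler_sum => ? _];
  rewrite lerXn2r ?nnegrE ?norm_Re_mx_le // !sumr_ge0 // => *; rewrite sumr_ge0.
Qed.

Lemma schatten_rotated_le p n t (Y : 'M[R[i]]_n) : 0 < p ->
  schatten_rotated p t Y <= schatten_numradius p Y.
Proof.
by move=> p0; apply: ub_le_sup; [exact: has_ubound_schatten_rotated|exists t].
Qed.

Lemma schatten_numradius_le p n (Y : 'M[R[i]]_n) c :
  (forall t, schatten_rotated p t Y <= c) -> schatten_numradius p Y <= c.
Proof.
move=> leYc; apply: ge_sup; last by move=> _ [t _ <-]; exact: leYc.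
by exists (schatten_rotated p 0 Y); exists 0.
Qed.

Lemma schatten_numradius_ge0 p n (Y : 'M[R[i]]_n) : 0 < p ->
  0 <= schatten_numradius p Y.
Proof.
by move=> p0; apply: le_trans (schatten_rotated_le 0 Y p0); exact: schatten_ge0.
Qed.

Lemma schatten_numradius_herm p n (H : 'M[R[i]]_n) : 0 < p ->
  H \is hermsymmx -> schatten_numradius p H = schatten p H.
Proof.
move=> p0 hH; have p_neq0 := lt0r_neq0 p0.
apply/eqP; rewrite eq_le; apply/andP; split.
  apply: schatten_numradius_le => t; rewrite schatten_rotated_herm //.
  by rewrite ler_piMl ?schatten_ge0 // ler_norml cos_geN1 cos_le1.
by rewrite -(schatten_rotated0_herm p_neq0 hH) schatten_rotated_le.
Qed.

Lemma schatten_numradius_offdiag p n (B : 'M[R[i]]_n) : 0 < p ->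
  schatten_numradius p (block_mx 0 B B 0) =
  2 `^ (1 / p) * schatten_numradius p B.
Proof.
move=> p0; have p_neq0 := lt0r_neq0 p0.
have rotE t : schatten_rotated p t (block_mx 0 B B 0) =
    2 `^ (1 / p) * schatten_rotated p t B.
  rewrite (schatten_rotated_symblock _ _ _ p_neq0) add0r sub0r {2}/schatten_rotated.
  rewrite scalerN Re_mxN (schattenN _ p_neq0) -/(schatten_rotated p t B).
  rewrite -mulr2n -[_ *+ 2]mulr_natl.
  by rewrite powRM ?powR_ge0 ?ler0n // powRK_inv ?schatten_ge0.
have pow2_gt0 : 0 < (2 : R) `^ (1 / p) by rewrite powR_gt0.
apply/eqP; rewrite eq_le; apply/andP; split.
  by apply: schatten_numradius_le => t; rewrite rotE ler_pM2l // schatten_rotated_le.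
rewrite -ler_pdivlMl //; apply: schatten_numradius_le => t.
by rewrite ler_pdivlMl // -rotE schatten_rotated_le.
Qed.

Lemma schatten_numradius_symblock_le p n (A B : 'M[R[i]]_n) : 0 < p ->
  schatten_numradius p (block_mx A B B A) <=
  (schatten_numradius p (A + B) `^ p + schatten_numradius p (A - B) `^ p)
    `^ (1 / p).
Proof.
move=> p0; apply: schatten_numradius_le => t.
rewrite (schatten_rotated_symblock _ _ _ (lt0r_neq0 p0)).
apply: ge0_ler_powR; rewrite ?nnegrE ?addr_ge0 ?powR_ge0 ?divr_ge0 ?(ltW p0) //.
by apply: lerD; apply: ge0_ler_powR;
  rewrite ?nnegrE ?schatten_ge0 ?schatten_numradius_ge0
    ?schatten_rotated_le ?(ltW p0).
Qed.

End Schatten.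

Theorem mainTheorem10 (R : realType) (p : R) (n : nat) (A B : 'M[R[i]]_n) :
  2 <= p ->
  [/\ schatten_numradius p (block_mx 0 B B 0)
        = 2 `^ (1 / p) * schatten_numradius p B,
      schatten_numradius p (block_mx A B B A)
        <= 1 / 2 `^ (2 / p - 1)
           * (schatten_numradius p (A + B) `^ p
              + schatten_numradius p (A - B) `^ p) `^ (1 / p)
    & A \is hermsymmx -> B \is hermsymmx ->
      schatten_numradius p (block_mx A B B A)
        = (schatten_numradius p (A + B) `^ p
           + schatten_numradius p (A - B) `^ p) `^ (1 / p)].
Proof.
move=> p2; have p0 : 0 < p by apply: lt_le_trans p2.
split=> [||hA hB]; first exact: schatten_numradius_offdiag.
  apply: le_trans (schatten_numradius_symblock_le _ _ p0) _.
  rewrite ler_peMl ?powR_ge0 // ler_pdivlMr ?powR_gt0 // mul1r.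
  rewrite -[leRHS](powRr0 2); apply: ler_powR; first by rewrite ler1n.
  by rewrite subr_le0 ler_pdivrMr // mul1r.
have hAB : A + B \is hermsymmx by exact: hermsymmxD.
have hAmB : A - B \is hermsymmx by exact: hermsymmxB.
apply/eqP; rewrite eq_le (schatten_numradius_symblock_le _ _ p0) /=.
rewrite (schatten_numradius_herm p0 hAB) (schatten_numradius_herm p0 hAmB).
have p_neq0 := lt0r_neq0 p0.
have := schatten_rotated_le 0 (block_mx A B B A) p0.
rewrite (schatten_rotated_symblock _ _ _ p_neq0).
by rewrite (schatten_rotated0_herm p_neq0 hAB) (schatten_rotated0_herm p_neq0 hAmB).
Qed.
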